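(* Let $\mathbb{F}$ be a field, let $n,k\in\mathbb{N}$ with $k<n-k$, and let $$A=\left(\begin{array}{c|c}\mathbf{0}_{k,k} & \mathbf{0}_{k,n-k}\\ \hline \mathbf{0}_{n-k,k} & A_{22}\end{array}\right)\in\mathbb{M}_n(\mathbb{F}),$$ where $A_{22}\in\mathbb{M}_{n-k}(\mathbb{F})$ is an invertible non-derogatory matrix. If the trace of $A$ is zero, then the following two statements are true: (i) if $n\ge 3$, there exist an $n$-potent matrix $P\in\mathbb{M}_n(\mathbb{F})$ and a square-zero matrix $N_1\in\mathbb{M}_n(\mathbb{F})$ such that $A=P+N_1$; (ii) if $n\ge 2$, there exist an $n$-torsion matrix $T\in\mathbb{M}_n(\mathbb{F})$ and a square-zero matrix $N_2\in\mathbb{M}_n(\mathbb{F})$ such that $A=T+N_2$.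
   Context: $\mathbb{M}_m(\mathbb{F})$ is the ring of $m\times m$ matrices over $\mathbb{F}$ and $\mathbf{0}_{r,s}$ is the $r\times s$ zero matrix. The value $k=0$ is allowed (then $A=A_{22}$). A matrix $N$ is square-zero if $N^2=0$. A square matrix is non-derogatory if its minimal polynomial equals its characteristic polynomial. For an integer $m>1$, a matrix $P$ is $m$-potent if $P^m=P$. For a positive integer $m$, a matrix $T$ is $m$-torsion if $T^m=\mathrm{Id}$. *)

(* Defs.v *)
From mathcomp Require Import all_boot all_order all_algebra.

Set Implicit Arguments.
Unset Strict Implicit.
Unset Printing Implicit Defensive.

Import GRing.Theory.
Local Open Scope ring_scope.

(* mxminpoly requires a dimension of the form m.+1; the 0 x 0 matrix, whose
   minimal and characteristic polynomials are both 1, is non-derogatory. *)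
Definition non_derogatory (F : fieldType) (m : nat) : 'M[F]_m -> Prop :=
  match m with
  | 0 => fun _ => True
  | _.+1 => fun B => mxminpoly B = char_poly B
  end.

Definition square_zero (F : fieldType) (m : nat) (N : 'M[F]_m) : Prop :=
  N ^+ 2 = 0.

(* Only meaningful for 1 < q. *)
Definition potent (F : fieldType) (q m : nat) (P : 'M[F]_m) : Prop :=
  P ^+ q = P.

(* Only meaningful for 0 < q. *)
Definition torsion (F : fieldType) (q m : nat) (T : 'M[F]_m) : Prop :=
  T ^+ q = 1%:M.

Lemma block_dim (n k : nat) : (k < n - k)%N -> (k + (n - k))%N = n.
Proof.
move=> hk; apply/subnKC/ltnW.
exact: leq_trans hk (leq_subr k n).
Qed.

Definition zero_corner_mx (F : fieldType) (n k : nat) (hk : (k < n - k)%N)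
    (A22 : 'M[F]_(n - k)) : 'M[F]_n :=
  castmx (block_dim hk, block_dim hk)
    (block_mx (0 : 'M_(k, k)) (0 : 'M_(k, n - k))
              (0 : 'M_(n - k, k)) A22).

(* Main.v *)
Require Import Defs.
From HB Require Import structures.
From mathcomp Require Import all_boot all_order all_algebra.
From mathcomp Require Import ring zify.

Import GRing.Theory.
Local Open Scope ring_scope.

(** The sum $A = P + N$ is sought with $N^2 = 0$ and $P$ similar to the
    companion matrix $C_q$ of a prescribed monic polynomial $q$ of degree $n$.
    On $F[X]/(q)$, multiplication by $X$ is $n$-torsion for $q = X^n - 1$ and
    $n$-potent for $q = X^n - X$. For $n >= 2$, respectively $n >= 3$, these
    polynomials have no term of degree $n - 1$, which matches the trace of $A$.
    So it is enough to show that every monic $q$ of degree $n$ without term of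
    degree $n - 1$ is reached ([sqz_realizes_block]).

    A non-derogatory matrix has a vector whose order is the minimal polynomial
    ([order_poly_mxminpoly]), here the characteristic polynomial $p$; hence
    $A_{22}$ is similar to $C_p$. Put $m = n - k$.

    If $k = 0$, the difference $C_p - C_q$ has its image in the line of
    $q - p$, and kills this line because $p$ and $q$ have the same coefficient
    in degree $n - 1$: it is square-zero.

    If $k > 0$, invertibility of $C_p$ shows that $A$ is similar to
    $[0, G; 0, C_p]$ for any block $G$, and subtracting a square-zero matrix
    $[0, 0; -Phi, 0]$ gives $T = [0, G; Phi, C_p]$ with $Phi$ arbitrary. Take
    $G = [I, 0]$. It remains to choose $Phi$ such that $T$ is similar to $C_q$
    ([chain_realizes]). With vectors written as rows, such a similarity is a
    basis $x_0, ..., x_{k-1}, y_0, ..., y_{m-1}$ of the polynomials of degree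
    $< n$, such that, modulo the span $S$ of the $x_i$ where indicated,
      - $y_i = X x_i$ for $i < k$,
      - $X y_i = y_{i+1}$ modulo $S$ for $i < m - 1$,
      - $X y_{m-1} = q - \sum_i p_i y_i$ modulo $S$;
    the coordinates of the discarded elements of $S$ form the rows of $Phi$.

    The choice $x_i = X^{2i} (1 + X)^{k-1-i}$ works. The relation
    $X^2 x_i = x_{i+1} + X x_{i+1}$ makes $y_i = X x_i$ satisfy the
    second condition for $i < k - 1$, and the $x_i$ and $X x_i$ together form a
    basis of the polynomials of degree $< 2 k$ since their orders at $0$ are
    $0, ..., 2 k - 1$ ([spanx_split]). Writing $y_{i+1} = X y_i + \xi_i$, the
    third condition becomes one polynomial equation, in which $\xi_i$ appears
    multiplied by the quotient of $p$ by $X^{i+1}$ ([chain_telescope]). Since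
    $x_{k-1} = X^{2k-2}$, multiples of $x_{k-1}$ taken as $\xi_i$ kill the
    terms of degree $>= 2 k$ from the top, and the last $\xi_{m-2}$ absorbs the
    multiples of $X$ that remain ([spanx_reduce]). *)

(** * Order polynomials and cyclic vectors *)

Section Cyclic.
Set Implicit Arguments.
Unset Strict Implicit.
Variables (F : fieldType) (n' : nat) (A : 'M[F]_n'.+1).
Local Notation n := n'.+1.
Implicit Types (u v : 'rV[F]_n) (f g h p : {poly F}).

Definition krylov_mx v s : 'M[F]_(s, n) := \matrix_(i < s) (v *m A ^+ i).

Lemma mul_krylov_mx v s (a : 'rV_s) :
  a *m krylov_mx v s = v *m horner_mx A (rVpoly a).
Proof.
rewrite mulmx_sum_row [rVpoly a]poly_def linear_sum mulmx_sumr.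
apply: eq_bigr => i _; rewrite rowK valK linearZ /= rmorphXn /= horner_mx_X.
by rewrite scalemxAr.
Qed.

Definition order_poly v f :=
  forall p, (v *m horner_mx A p == 0) = (f %| p).

(** The polynomials killing [v] form an ideal, and a nonzero element of least
    degree generates it. The kernel of a Krylov matrix decides whether a
    smaller one exists, which makes the descent constructive. *)
Lemma order_poly_exists v : exists f, order_poly v f.
Proof.
have [f [f0 vf]]: exists f, f != 0 /\ v *m horner_mx A f = 0.
  exists (char_poly A); split; first exact/monic_neq0/char_poly_monic.
  by rewrite Cayley_Hamilton mulmx0.
move: {2}(size f) (leqnn (size f)) => s; elim: s f f0 vf => [|s IH] f f0 vf sf.
  by rewrite leqn0 size_poly_eq0 (negPf f0) in sf.
have [/row_free_inj injK | ] := boolP (row_free (krylov_mx v (size f).-1)).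
  exists f => p; apply/eqP/idP => [vp | /Pdiv.Field.dvdpP[q ->]]; last first.
    by rewrite mulrC rmorphM /= mulmxA vf mul0mx.
  have sr : (size (p %% f)%R <= (size f).-1)%N.
    by rewrite -ltnS prednK ?size_poly_gt0 // ltn_modp.
  have : v *m horner_mx A (p %% f) = 0.
    have := vp; rewrite {1}(Pdiv.Field.divp_eq p f) mulrC rmorphD rmorphM /=.
    by rewrite mulmxDr mulmxA vf mul0mx add0r.
  rewrite -(poly_rV_K sr) -mul_krylov_mx.
  rewrite -[0](mul0mx _ (krylov_mx v (size f).-1)) => r0.
  by rewrite /dvdp -(poly_rV_K sr) (injK _ _ _ r0) linear0.
rewrite -kermx_eq0 => /rowV0Pn[a /sub_kermxP va a0].
apply: (IH (rVpoly a)).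
- by apply: contraNneq a0 => ra0; rewrite -(rVpolyK a) ra0 linear0.
- by rewrite -mul_krylov_mx.
- apply: leq_trans (size_poly _ _) _; lia.
Qed.

Lemma order_polyM v f g :
  f != 0 -> order_poly v (f * g) -> order_poly (v *m horner_mx A f) g.
Proof. by move=> f0 vfg p; rewrite -mulmxA mulmxE -rmorphM vfg dvdp_mul2l. Qed.

Lemma order_polyD u v f g :
  coprimep f g -> order_poly u f -> order_poly v g ->
  order_poly (u + v) (f * g).
Proof.
move=> cfg uf vg p; rewrite Gauss_dvdp //; apply/eqP/andP => [uvp | [fp gp]].
  have {}uvp q : v *m horner_mx A (p * q) = - (u *m horner_mx A (p * q)).
    apply/eqP; rewrite -addr_eq0 addrC -mulmxDl rmorphM /= mulmxA uvp.
    by rewrite mul0mx.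
  split.
    by rewrite -(Gauss_dvdpl _ cfg) -uf -oppr_eq0 -uvp vg dvdp_mulIr.
  rewrite coprimep_sym in cfg.
  by rewrite -(Gauss_dvdpl _ cfg) -vg uvp oppr_eq0 uf dvdp_mulIr.
rewrite mulmxDl; move: fp gp; rewrite -uf -vg => /eqP-> /eqP->.
by rewrite addr0.
Qed.

(** If [g] does not divide [f], some combination of multiples of [u] and [v] has
    order of larger degree. With [h = g / gcd f g], split [f = f1 * f2], where
    [f1] is prime to [h] and [f2] divides a power of [h]. Then [f2] divides
    [gcd f g], so that [f2 * h] divides [g]; as [f1] and [f2 * h] are coprime,
    they are orders of two vectors whose sum has order [f1 * f2 * h = f * h]. *)
Lemma order_poly_grow u v f g :
    f != 0 -> g != 0 -> order_poly v f -> order_poly u g -> ~~ (g %| f) ->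
  exists w h, [/\ h != 0, order_poly w h & (size f < size h)%N].
Proof.
move=> f0 g0 vf ug gf.
set d := gcdp f g; set h := g %/ d.
have d0 : d != 0 by rewrite gcdp_eq0 negb_and f0.
have gE : g = d * h by rewrite mulrC divpK // dvdp_gcdr.
have h0 : h != 0 by apply: contraNneq g0 => h0; rewrite gE h0 mulr0.
set f1 := gdcop h f; have cf1 : coprimep f1 h by exact: coprimep_gdco.
have f1f : f1 %| f by exact: dvdp_gdco.
set f2 := f %/ f1; have fE : f = f1 * f2 by rewrite mulrC divpK.
have f1_0 : f1 != 0 by apply: contraNneq f0 => E; rewrite fE E mul0r.
have f2_0 : f2 != 0 by apply: contraNneq f0 => E; rewrite fE E mulr0.
have f2h : f2 %| h ^+ size f.
  by rewrite -(dvdp_mul2l _ _ f1_0) -fE; exact: dvdp_gdcor.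
(* f2 divides f = (f / d) * d and is prime to f / d, as h is. *)
have f2d : f2 %| d.
  have : coprimep f2 (f %/ d).
    apply: coprimep_dvdr f2h _; apply/coprimep_expl.
    rewrite coprimep_sym; apply: coprimep_div_gcd; rewrite f0 //.
  move/Gauss_dvdpl <-; rewrite mulrC divpK ?dvdp_gcdl //.
  by rewrite fE dvdp_mulIr.
have hf : (1 < size h)%N.
  rewrite ltnNge; apply: contra gf => sh.
  have : size h == 1 by rewrite eqn_leq sh size_poly_gt0.
  case/size_poly1P=> c c0 hE.
  by rewrite gE hE mulrC mul_polyC dvdpZl // dvdp_gcdl.
have := f2d; case/Pdiv.Field.dvdpP => e dE.
exists (v *m horner_mx A f2 + u *m horner_mx A e), (f1 * (f2 * h)).
have e0 : e != 0 by apply: contraNneq d0 => E; rewrite dE E mul0r.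
split; first by rewrite !mulf_neq0.
  apply: order_polyD.
  - rewrite coprimepMr cf1 andbT; apply: coprimep_dvdl f2h _.
    exact/coprimep_expr.
  - by apply: order_polyM; rewrite // mulrC -fE.
  - by apply: order_polyM; rewrite // mulrA -dE -gE.
rewrite mulrA -fE size_mul //; move: hf f0; rewrite -size_poly_gt0.
case: (size f) (size h) => [|a] [|[|b]] // _ _.
by rewrite !addnS /= ltnS ltnS leq_addr.
Qed.

Lemma order_poly_neq0 v f : order_poly v f -> f != 0.
Proof.
move=> vf; apply: contraTneq isT => f0.
have := vf (char_poly A); rewrite Cayley_Hamilton mulmx0 eqxx f0 => /esym.
by rewrite dvd0p (negPf (monic_neq0 (char_poly_monic A))).
Qed.

Lemma order_poly_size v f : order_poly v f -> (size f <= n.+1)%N.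
Proof.
move=> vf; rewrite -(size_char_poly A); apply: dvdp_leq.
  exact/monic_neq0/char_poly_monic.
by rewrite -vf Cayley_Hamilton mulmx0.
Qed.

(** A vector whose order has maximal degree has an order divisible by the order
    of every basis vector, so this order kills [A]. *)
Lemma order_poly_mxminpoly : exists v, order_poly v (mxminpoly A).
Proof.
suff [v [f [vf fA]]] : exists v f, order_poly v f /\ horner_mx A f = 0.
  exists v => p; rewrite vf; apply/idP/idP.
    exact: dvdp_trans (mxminpoly_min fA).
  by move/mxminpoly_minP=> pA; rewrite -vf pA mulmx0.
have [f vf] := order_poly_exists 0.
move: (0 : 'rV_n) f vf => v f.
have [s] := ubnP (n.+1 - size f)%N; elim: s v f => // s IH v f fs vf.
have [/forallP fA | ] := boolP [forall i, row i (horner_mx A f) == 0].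
  by exists v, f; split=> //; apply/row_matrixP=> i; rewrite (eqP (fA i)) row0.
rewrite negb_forall => /existsP[i fi].
have [g ig] := order_poly_exists (delta_mx 0 i).
have gf : ~~ (g %| f) by rewrite -ig -rowE.
have [w [h [h0 wh fh]]] :=
  order_poly_grow (order_poly_neq0 vf) (order_poly_neq0 ig) vf ig gf.
apply: (IH w h) => //; have := order_poly_size wh; lia.
Qed.

End Cyclic.

(** * Multiplication by X modulo a polynomial *)

Section MulX.
Set Implicit Arguments.
Unset Strict Implicit.
Variables (F : fieldType) (n : nat).
Implicit Types (f p q : {poly F}).

Definition mulX_mod q (v : 'rV[F]_n) : 'rV[F]_n :=
  poly_rV (('X * rVpoly v) %% q).

Fact mulX_mod_is_linear q : linear (mulX_mod q).
Proof.
move=> a u v; rewrite /mulX_mod linearP /= mulrDr -scalerAr modpD modpZl.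
by rewrite linearP.
Qed.
HB.instance Definition _ q :=
  GRing.isLinear.Build F 'rV[F]_n 'rV[F]_n _
    (mulX_mod q) (mulX_mod_is_linear q).

(** A companion matrix of [q], when [q] is monic of degree [n]. Acting on row
    vectors read as polynomials, it keeps the dimension [n] independent of
    [size q]. *)
Definition mulX_mx q : 'M[F]_n := lin1_mx (mulX_mod q).

Lemma mul_mulX_mx q f : (size f <= n)%N ->
  poly_rV f *m mulX_mx q = poly_rV (('X * f) %% q).
Proof. by move=> sf; rewrite mul_rV_lin1 /= /mulX_mod poly_rV_K. Qed.

Lemma mul_mulX_mxX q f j : size q = n.+1 -> (size f <= n)%N ->
  poly_rV f *m mulX_mx q ^+ j = poly_rV (('X^j * f) %% q).
Proof.
move=> sq sf; elim: j => [|j IH].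
  by rewrite expr0 mulmx1 expr0 mul1r modp_small // sq ltnS.
rewrite exprSr mulmxA IH mul_mulX_mx; last first.
  by rewrite -ltnS -sq ltn_modp -size_poly_eq0 sq.
by rewrite modp_mul mulrA -exprS.
Qed.

Lemma matrix_eq_rVpoly (m : nat) (A B : 'M[F]_(n, m)) :
  (forall f, (size f <= n)%N -> poly_rV f *m A = poly_rV f *m B) -> A = B.
Proof.
move=> AB; apply/row_matrixP => i; rewrite !rowE -[delta_mx _ _]rVpolyK.
by apply: AB; exact: size_poly.
Qed.

Lemma mulX_mx_torsion : (0 < n)%N -> mulX_mx ('X^n - 1) ^+ n = 1.
Proof.
move=> n0; apply: matrix_eq_rVpoly => f sf.
have sq : size ('X^n - 1 : {poly F}) = n.+1 by rewrite size_XnsubC.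
rewrite mul_mulX_mxX // mulmx1; congr poly_rV.
by apply/esym/(modpP (q := f)); rewrite ?sq // mulrBr mulr1 subrK mulrC.
Qed.

Lemma mulX_mx_potent : (1 < n)%N ->
  mulX_mx ('X^n - 'X) ^+ n = mulX_mx ('X^n - 'X).
Proof.
move=> n1; apply: matrix_eq_rVpoly => f sf.
have sq : size ('X^n - 'X : {poly F}) = n.+1.
  by rewrite size_polyDl size_polyXn // size_polyN size_polyX.
rewrite mul_mulX_mxX // mul_mulX_mx //; congr poly_rV.
by rewrite -{1}(subrK 'X 'X^n) mulrDl modpD modp_mulr add0r.
Qed.

End MulX.

(** The Krylov matrix is the matrix of the map sending a polynomial [f] to
    [v *m horner_mx A f], which turns multiplication by [X] into [A];
    reduction modulo the characteristic polynomial is harmless by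
    Cayley-Hamilton. *)
Lemma krylov_mulX (F : fieldType) n (A : 'M[F]_n.+1) v :
  krylov_mx A v n.+1 *m A = mulX_mx n.+1 (char_poly A) *m krylov_mx A v n.+1.
Proof.
set p := char_poly A; have sp : size p = n.+2 by exact: size_char_poly.
apply: matrix_eq_rVpoly => f sf.
rewrite !mulmxA mul_mulX_mx // !mul_krylov_mx !poly_rV_K //; last first.
  by rewrite -ltnS -sp ltn_modp -size_poly_eq0 sp.
have -> : horner_mx A (('X * f) %% p) = horner_mx A ('X * f).
  rewrite [in RHS](Pdiv.Field.divp_eq ('X * f) p) rmorphD rmorphM /=.
  by rewrite Cayley_Hamilton mulr0 add0r.
by rewrite mulrC rmorphM /= horner_mx_X mulmxA.
Qed.

Lemma krylov_unit (F : fieldType) n (A : 'M[F]_n.+1) v :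
  order_poly A v (char_poly A) -> krylov_mx A v n.+1 \in unitmx.
Proof.
move=> vp; rewrite -row_free_unit -kermx_eq0; apply/rowV0P => a /sub_kermxP.
rewrite mul_krylov_mx => /eqP; rewrite vp => pa; apply/eqP; rewrite -[a]rVpolyK.
apply: contraTT pa => a0; apply: contraL isT => /dvdp_leq.
rewrite size_char_poly => le; have := le _.
rewrite ltnNge size_poly /= => -> //.
by apply: contraNneq a0 => ->; rewrite linear0.
Qed.

(** * Chains of polynomials *)

Section PolyChain.
Set Implicit Arguments.
Unset Strict Implicit.
Variable F : fieldType.
Implicit Types (h s t p q : {poly F}) (k m n i j : nat).

(** Chosen for the relation [X^2 x_i = x_(i+1) + X x_(i+1)] and for the orders
    at zero: [2i] for [x_i] and [2i + 1] for [X x_i]. *)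
Definition xpoly k i : {poly F} := 'X^(i.*2) * (1 + 'X) ^+ (k.-1 - i).

Definition spanx k h := exists a : nat -> F, h = \sum_(i < k) a i *: xpoly k i.

Lemma spanx_xpoly k i : (i < k)%N -> spanx k (xpoly k i).
Proof.
move=> ik; exists (fun j => (j == i)%:R).
rewrite (bigD1 (Ordinal ik)) //= eqxx scale1r big1 ?addr0 // => j.
by rewrite -val_eqE /= => /negPf->; rewrite scale0r.
Qed.

Lemma spanxZ k c h : spanx k h -> spanx k (c *: h).
Proof.
case=> a ->; exists (fun i => c * a i); rewrite scaler_sumr.
by apply: eq_bigr => i _; rewrite scalerA.
Qed.

Lemma spanxD k s t : spanx k s -> spanx k t -> spanx k (s + t).
Proof.
case=> a -> [b ->]; exists (fun i => a i + b i); rewrite -big_split /=.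
by apply: eq_bigr => i _; rewrite scalerDl.
Qed.

Lemma spanxN k s : spanx k s -> spanx k (- s).
Proof. by move=> ks; rewrite -scaleN1r; apply: spanxZ. Qed.

Lemma xpoly0 k : xpoly k.+1 0 = (1 + 'X) ^+ k.
Proof. by rewrite /xpoly expr0 mul1r subn0. Qed.

Lemma size_xpoly k i : (i < k)%N -> size (xpoly k i) = (k + i)%N.
Proof.
move=> ik; rewrite /xpoly; have -> : 1 + 'X = 'X - (-1)%:P :> {poly F}.
  by rewrite polyCN opprK addrC.
rewrite mulrC size_mulXn ?expf_neq0 ?polyXsubC_eq0 // size_exp_XsubC.
lia.
Qed.

Lemma size_spanx k s : spanx k s -> (size s <= (k.*2).-1)%N.
Proof.
case=> a ->; apply/(leq_trans (size_sum _ _ _))/bigmax_leqP => i _.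
apply: leq_trans (size_scale_leq _ _) _; rewrite size_xpoly //.
have := ltn_ord i; lia.
Qed.

Lemma factorX h : h`_0 = 0 -> exists g, h = 'X * g.
Proof.
move=> h0; exists (drop_poly 1 h); rewrite -{1}(poly_take_drop 1 h) mulrC.
rewrite [take_poly _ _]size1_polyC ?size_take_poly //.
by rewrite coef_take_poly /= h0 polyC0 add0r expr1.
Qed.

(** The orders at zero of [x_0, X x_0, x_1, X x_1, ...] are [0, 1, 2, 3, ...],
    so a polynomial can be decomposed from its low-order terms up: after the
    multiples of [x_0] and [X x_0] are removed, the rest is divisible by [X^2],
    and dividing by [X^2] lowers [k] by one. *)
Lemma spanx_split k h : (size h <= k.*2)%N ->
  exists s t, [/\ spanx k s, spanx k t & h = s + 'X * t].
Proof.
elim: k h => [|k IH] h sh.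
  have -> : h = 0 by apply/eqP; rewrite -size_poly_leq0.
  by exists 0, 0; split; rewrite ?mulr0 ?addr0 //;
    exists (fun=> 0); rewrite big_ord0.
have unit0 (c : {poly F}) : (c - c`_0 *: (1 + 'X) ^+ k)`_0 = 0.
  rewrite coefB coefZ -(horner_coef0 (_ ^+ _)) horner_exp !hornerE.
  by rewrite expr1n mulr1 subrr.
have [g gE] := factorX (unit0 h); have [e eE] := factorX (unit0 g).
have hE : h = h`_0 *: (1 + 'X) ^+ k + 'X * (g`_0 *: (1 + 'X) ^+ k + 'X * e).
  by rewrite -eE addrCA subrr addr0 -gE addrCA subrr addr0.
have sk c : (size (c *: (1 + 'X : {poly F}) ^+ k)%R <= k.+1)%N.
  apply: leq_trans (size_scale_leq _ _) _.
  by rewrite -xpoly0 size_xpoly // addn0.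
have sX c : (size ('X * c : {poly F})%R <= (size c).+1)%N.
  apply: leq_trans (size_polyMleq _ _) _; rewrite size_polyX; lia.
have se : (size e <= k.*2)%N.
  have [->|e0] := eqVneq e 0; first by rewrite size_poly0.
  have : (size ('X * ('X * e))%R <= k.+1.*2)%N.
    have -> : 'X * ('X * e) =
        h - h`_0 *: (1 + 'X) ^+ k - 'X * (g`_0 *: (1 + 'X) ^+ k).
      by rewrite {1}hE; ring.
    rewrite (leq_trans (size_polyD _ _)) // geq_max size_polyN.
    apply/andP; split.
      rewrite (leq_trans (size_polyD _ _)) // geq_max size_polyN sh /=.
      by apply: leq_trans (sk _) _; lia.
    by apply: leq_trans (sX _) _; have := sk g`_0; lia.
  by rewrite !(mulrC 'X) !size_mulX ?mulf_neq0 ?polyX_eq0 // doubleS.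
have lift s c : spanx k s -> spanx k.+1 (c *: (1 + 'X) ^+ k + 'X^2 * s).
  case=> a ->; exists (fun i => if i is j.+1 then a j else c).
  rewrite big_ord_recl /= xpoly0; congr (_ + _).
  rewrite mulr_sumr; apply: eq_bigr => i _; rewrite -scalerAr; congr (_ *: _).
  rewrite /xpoly mulrA -exprD /= /bump /= add1n doubleS; congr ('X^_ * _ ^+ _).
  by have := ltn_ord i; lia.
have [s [t [ks kt est]]] := IH _ se.
exists (h`_0 *: (1 + 'X) ^+ k + 'X^2 * s), (g`_0 *: (1 + 'X) ^+ k + 'X^2 * t).
split; [exact: lift | exact: lift |].
by rewrite {1}hE est; ring.
Qed.

Lemma drop_poly_step p i : drop_poly i p = (p`_i)%:P + 'X * drop_poly i.+1 p.
Proof.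
apply/polyP => j; rewrite coef_drop_poly coefD coefC coefXM.
by case: j => [|j] /=; rewrite ?addr0 // add0r coef_drop_poly addSnnS.
Qed.

Lemma drop_poly_top p m : p \is monic -> size p = m.+1 -> drop_poly m p = 1.
Proof.
move=> /monicP pm sp; rewrite -[drop_poly _ _]coefK size_drop_poly sp subSnn.
rewrite poly_def big_ord1 expr0 coef_drop_poly add0n.
by move: pm; rewrite /lead_coef sp /= => ->; rewrite scale1r.
Qed.

(** Choosing the [xi j] amounts to a division: [drop_poly j.+1 p] is monic of
    degree [m - 1 - j] and the last element [x_(k-1)] of the family is
    [X^(2k-2)], so each scalar multiple of [x_(k-1)] removes one leading term,
    down to degree [2k]. Then [h = s + X t], and the last factor, of the form
    [X + c], removes [X t]. *)
Lemma spanx_reduce k m p d c h :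
    p \is monic -> size p = m.+1 -> (0 < k)%N -> (c + d).+2 = m ->
    (size h <= d + k.*2)%N ->
  exists xi : nat -> {poly F}, (forall j, spanx k (xi j)) /\
    spanx k (h - \sum_(c <= j < m.-1) drop_poly j.+1 p * xi j).
Proof.
move=> pm sp k0 cdm; elim: d c cdm h => [|d IH] c cdm h sh.
  have [s [t [ks kt ->]]] := spanx_split sh.
  exists (fun=> t); split=> //; rewrite -cdm addn0 /= big_nat1.
  rewrite drop_poly_step.
  have -> : drop_poly c.+2 p = 1.
    by apply: drop_poly_top; rewrite // sp -cdm addn0.
  rewrite mulr1 mulrDl mul_polyC opprD addrACA subrr addr0.
  by apply/spanxD/spanxN/spanxZ.
set x := xpoly k k.-1; set P := drop_poly c.+1 p.
have xE : x = 'X^((k.-1).*2) by rewrite /x /xpoly subnn mulr1.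
set a := h`_(d + k.*2).
have sP : size P = d.+3 by rewrite size_drop_poly sp; lia.
have sh' : (size (h - P * (a *: x))%R <= d + k.*2)%N.
  apply/leq_sizeP => j; rewrite leq_eqVlt => /predU1P[<- | jl].
    rewrite coefB -scalerAr coefZ xE coefMXn ifF; last by apply/negbTE; lia.
    (* The leading coefficients agree: that of P is the one of p. *)
    have -> : (d + k.*2 - k.-1.*2 = d.+2)%N by lia.
    rewrite coef_drop_poly.
    have -> : (d.+2 + c.+1 = m)%N by lia.
    by move/monicP: pm; rewrite /lead_coef sp /= => ->; rewrite mulr1 subrr.
  apply: nth_default; apply: leq_trans jl; rewrite -addSn.
  rewrite (leq_trans (size_polyD _ _)) // geq_max size_polyN sh /=.
  rewrite -scalerAr; apply: leq_trans (size_scale_leq _ _) _.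
  by rewrite xE size_mulXn ?sP -?size_poly_eq0 ?sP //; lia.
have [|xi [kxi khi]] := IH c.+1 _ _ sh'; first by lia.
exists (fun j => if j == c then a *: x else xi j); split=> [j|].
  case: ifP => // _; apply/spanxZ/spanx_xpoly; lia.
rewrite big_ltn; last by lia.
rewrite eqxx opprD addrA -/P; move: khi; congr (spanx k (_ - _)).
by apply: eq_big_nat => j /andP[cj _]; rewrite ifF //; apply/negbTE; lia.
Qed.

(** The corrections [xi] will lie in the span of the [xpoly k i]; up to
    sign, their coordinates there are the rows of the block [Phi] other than
    the last one, which comes from the closing condition. *)
Fixpoint chain k (xi : nat -> {poly F}) i : {poly F} :=
  if i is j.+1 then 'X * chain k xi j + xi j else 'X * xpoly k 0.

(** Horner's rule: [drop_poly i p] is [p`_i] plus ['X] times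
    [drop_poly i.+1 p], and ['X] times the [i]-th term of the chain is the next
    term minus [xi i]. Thus the sum of the [p`_i *: chain k xi i] depends
    linearly on the corrections. *)
Lemma chain_telescope k xi p i :
  p * chain k xi 0 + \sum_(0 <= j < i) drop_poly j.+1 p * xi j
  = \sum_(0 <= j < i) p`_j *: chain k xi j + drop_poly i p * chain k xi i.
Proof.
elim: i => [|i IH]; first by rewrite !big_geq // addr0 add0r drop_poly0l.
rewrite !big_nat_recr //= addrA IH {1}drop_poly_step -mul_polyC; ring.
Qed.

(** The closing condition leaves a polynomial [h], known before the free
    corrections are chosen, to be reduced into the span. The assumption
    [p`_m.-1 = q`_(k + m).-1] says that [h] has degree at most [k + m - 2],
    which is what [spanx_reduce] can handle from index [k - 1] on. *)
Lemma chain_exists k m p q :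
    (0 < k < m)%N -> p \is monic -> size p = m.+1 ->
    q \is monic -> size q = (k + m).+1 -> p`_m.-1 = q`_(k + m).-1 ->
  exists y : nat -> {poly F},
    [/\ forall i, (i < k)%N -> y i = 'X * xpoly k i,
        forall i, spanx k (y i.+1 - 'X * y i),
        forall i, (size (y i) <= (k + i).+1)%N &
        spanx k (\sum_(i < m) p`_i *: y i + 'X * y m.-1 - q)].
Proof.
case/andP=> k0 km pm sp qm sq pq.
pose h := q - \sum_(0 <= i < k.-1) p`_i *: ('X * xpoly k i)
            - drop_poly k.-1 p * 'X^((k.*2).-1).
have sX c : (size ('X * c : {poly F})%R <= (size c).+1)%N.
  apply: leq_trans (size_polyMleq _ _) _; rewrite size_polyX; lia.
have sh : (size h <= (m - k.+1) + k.*2)%N.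
  apply/leq_sizeP => j jl; rewrite !coefB coefMXn ifF; last first.
    by apply/negbTE; lia.
  rewrite coef_drop_poly.
  have -> : (\sum_(0 <= i < k.-1) p`_i *: ('X * xpoly k i))`_j = 0.
    rewrite big_nat coef_sum big1 // => i /andP[_ ik].
    rewrite coefZ [X in _ * X]nth_default ?mulr0 //.
    by apply: leq_trans (sX _) _; rewrite size_xpoly; lia.
  have -> : (j - (k.*2).-1 + k.-1 = j - k)%N by lia.
  rewrite subr0.
  have [->|jn] := eqVneq j (k + m).-1.
    by have -> : ((k + m).-1 - k = m.-1)%N by [lia]; rewrite pq subrr.
  have [->|jn'] := eqVneq j (k + m)%N.
    rewrite addKn; move/monicP: pm; move/monicP: qm.
    rewrite /lead_coef sp sq /=.
    by move=> -> ->; rewrite subrr.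
  by rewrite !nth_default ?subrr // ?sp ?sq; lia.
have [|xi' [kxi' khi']] := spanx_reduce (c := k.-1) pm sp k0 _ sh; first by lia.
(* Below k - 1 the corrections are forced by y_i = X x_i. *)
pose xi j := if (j < k.-1)%N then - xpoly k j.+1 else xi' j.
have kxi j : spanx k (xi j).
  rewrite /xi; case: ifP => // jk; apply/spanxN/spanx_xpoly; lia.
have yk i : (i < k)%N -> chain k xi i = 'X * xpoly k i.
  elim: i => //= i IH ik; rewrite IH; last by lia.
  rewrite /xi ifT; last by lia.
  rewrite /xpoly; have -> : (k.-1 - i = (k.-1 - i.+1).+1)%N by lia.
  rewrite exprS doubleS !exprS; ring.
exists (chain k xi); split=> //.
- by move=> i; rewrite /= addrC addKr.
- elim=> [|i IH].
    by rewrite /= (leq_trans (sX _)) // size_xpoly.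
  have [ik|ik] := ltnP i.+1 k.
    by rewrite yk //; apply: leq_trans (sX _) _; rewrite size_xpoly // addn0.
  rewrite (leq_trans (size_polyD _ _)) // geq_max; apply/andP; split.
    by rewrite addnS (leq_trans (sX _)).
  by apply: leq_trans (size_spanx (kxi i)) _; lia.
have := chain_telescope k xi p m.-1.
rewrite (drop_poly_step _ m.-1) prednK; last by lia.
rewrite drop_poly_top // mulr1 mulrDl mul_polyC addrA.
rewrite -(big_nat_recr _ _ (fun j => p`_j *: chain k xi j)) //=.
rewrite prednK; last by lia.
rewrite (big_mkord xpredT (fun j => p`_j *: chain k xi j)) => <-.
rewrite (@big_cat_nat _ _ _ k.-1) //=; last by lia.
rewrite addrA (chain_telescope k xi p k.-1) yk; last by lia.
rewrite -[X in spanx k X]opprK; apply: spanxN; move: khi'; congr spanx.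
rewrite (_ : xpoly k k.-1 = 'X^((k.-1).*2)); last by rewrite /xpoly subnn mulr1.
rewrite -exprS (_ : (k.-1.*2).+1 = (k.*2).-1); last by lia.
have -> : \sum_(0 <= j < k.-1) p`_j *: chain k xi j =
          \sum_(0 <= i < k.-1) p`_i *: ('X * xpoly k i).
  by apply: eq_big_nat => i /andP[_ ik]; rewrite yk //; lia.
rewrite /h.
rewrite (_ : \sum_(k.-1 <= i < m.-1) drop_poly i.+1 p * xi i =
             \sum_(k.-1 <= j < m.-1) drop_poly j.+1 p * xi' j).
  by ring.
apply: eq_big_nat => i /andP[ki _]; rewrite /xi ifF //; apply/negbTE; lia.
Qed.

End PolyChain.

(** * A block matrix similar to a companion matrix *)

Section Realization.
Set Implicit Arguments.
Unset Strict Implicit.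
Variable F : fieldType.

Definition rows_of m n (y : nat -> {poly F}) : 'M[F]_(m, n) :=
  \matrix_(i < m) poly_rV (y i).

Lemma mul_rows_of m n (y : nat -> {poly F}) (f : {poly F}) :
  poly_rV f *m rows_of m n y = poly_rV (\sum_(i < m) f`_i *: y i).
Proof.
rewrite mulmx_sum_row linear_sum; apply: eq_bigr => i _.
by rewrite rowK mxE linearZ.
Qed.

Lemma delta_rV m (i : 'I_m) : delta_mx 0 i = poly_rV 'X^i :> 'rV[F]_m.
Proof. by apply/rowP => j; rewrite !mxE coefXn. Qed.

Lemma spanx_sub k n h :
  spanx k h -> (poly_rV h <= rows_of k n (xpoly F k))%MS.
Proof.
case=> a ->; rewrite linear_sum summx_sub // => i _.
by rewrite linearZ scalemx_sub // (eq_row_sub i) // rowK.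
Qed.

(** The rows of [K] are the polynomials [x_i], then [y_i], of [chain_exists].
    [K] is invertible because its row space is stable under multiplication by
    [X] modulo [q] and contains [1], by [spanx_split]. *)
Lemma chain_realizes k m (p q : {poly F}) :
    (0 < k < m)%N -> p \is monic -> size p = m.+1 ->
    q \is monic -> size q = (k + m).+1 -> p`_m.-1 = q`_(k + m).-1 ->
  exists (Phi : 'M[F]_(m, k)) (K : 'M[F]_(k + m)), K \in unitmx /\
    block_mx 0 (pid_mx k) Phi (mulX_mx m p) *m K = K *m mulX_mx (k + m) q.
Proof.
move=> km pm sp qm sq pq.
have [y [yx ystep ysize ylast]] := chain_exists km pm sp qm sq pq.
case/andP: km => k0 km.
set C := mulX_mx (k + m) q; set X := rows_of k (k + m) (xpoly F k).
set Y := rows_of m (k + m) y.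
have sX c : (size ('X * c : {poly F})%R <= (size c).+1)%N.
  apply: leq_trans (size_polyMleq _ _) _; rewrite size_polyX; lia.
have rowYC i : (i < m)%N -> poly_rV (y i) *m C = poly_rV (('X * y i) %% q).
  by move=> im; apply: mul_mulX_mx; have := ysize i; lia.
have : (Y *m C - mulX_mx m p *m Y <= X)%MS.
  apply/row_subP => i; rewrite linearB /= !row_mul rowK rowYC //.
  rewrite rowE delta_rV mul_mulX_mx ?size_polyXn // mul_rows_of -linearB /=.
  rewrite -exprS; apply: spanx_sub.
  have [im|im] := ltnP i.+1 m.
    rewrite !modp_small ?sp ?sq ?size_polyXn //; last first.
      by rewrite ltnS (leq_trans (sX _)) // (leq_ltn_trans (ysize i)); lia.
    rewrite (bigD1 (Ordinal im)) //= coefXn eqxx scale1r big1 ?addr0.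
      by rewrite -opprB; apply: spanxN.
    by move=> j; rewrite -val_eqE coefXn /= => /negPf->; rewrite scale0r.
  have iE : i = m.-1 :> nat by have := ltn_ord i; lia.
  rewrite iE (prednK (ltn_trans k0 km)).
  have -> : 'X^m %% p = 'X^m - p.
    apply/esym/(modpP (q := 1)); first by rewrite mul1r addrC subrK.
    rewrite sp; apply/leq_sizeP => j; rewrite coefB coefXn leq_eqVlt.
    case/predU1P => [<- | mj].
      by move/monicP: pm; rewrite /lead_coef sp eqxx => ->; rewrite subrr.
    by rewrite gtn_eqF // nth_default ?subrr // sp.
  have sum_p : \sum_(j < m) ('X^m - p)`_j *: y j = - \sum_(j < m) p`_j *: y j.
    rewrite -sumrN; apply: eq_bigr => j _.
    by rewrite coefB coefXn ltn_eqF // sub0r scaleNr.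
  move: ylast; rewrite sum_p opprK; set s := (_ + _ - q) => ks.
  suff -> : ('X * y m.-1) %% q = s - \sum_(j < m) p`_j *: y j.
    by rewrite subrK.
  apply/esym/(modpP (q := 1)); first by rewrite /s; ring.
  rewrite sq ltnS (leq_trans (size_polyD _ _)) // geq_max size_polyN.
  apply/andP; split; first by have := size_spanx ks; lia.
  apply: leq_trans (size_sum _ _ _) _; apply/bigmax_leqP => j _.
  apply: leq_trans (size_scale_leq _ _) _.
  by apply: leq_trans (ysize j) _; rewrite -addnS leq_add2l.
case/submxP => Phi PhiE; exists Phi, (col_mx X Y).
have intertwine :
    block_mx 0 (pid_mx k) Phi (mulX_mx m p) *m col_mx X Y = col_mx X Y *m C.
  rewrite mul_block_col mul_col_mx mul0mx add0r -PhiE subrK; congr col_mx.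
  apply/row_matrixP => i; rewrite !row_mul rowK.
  have im : (i < m)%N by apply: ltn_trans km.
  rewrite mul_mulX_mx; last by rewrite size_xpoly //; lia.
  rewrite modp_small -?yx //; last first.
    by rewrite sq ltnS (leq_trans (ysize i)); lia.
  have -> : row i (pid_mx k) = delta_mx 0 (Ordinal im) :> 'rV[F]_m.
    by apply/rowP => j; rewrite !mxE ltn_ord andbT eqxx [RHS]/= -val_eqE eq_sym.
  by rewrite -rowE rowK.
split=> //; rewrite -row_full_unit -sub1mx.
have Xsub : (X <= col_mx X Y)%MS by rewrite -addsmxE addsmxSl.
have Ysub : (Y <= col_mx X Y)%MS by rewrite -addsmxE addsmxSr.
apply/row_subP => i; rewrite row1 delta_rV.
elim: (i : nat) (ltn_ord i) => [_|j IH jn].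
  have s1 : (size (1%R : {poly F}) <= k.*2)%N by rewrite size_poly1; lia.
  have [s [t [ks kt stE]]] := spanx_split s1.
  rewrite expr0 stE linearD addmx_sub //.
    by apply: submx_trans Xsub; exact: spanx_sub.
  case: kt => a ->; rewrite mulr_sumr linear_sum summx_sub // => l _.
  rewrite -scalerAr linearZ scalemx_sub // -yx //.
  have lm : (l < m)%N by apply: ltn_trans km.
  by apply: submx_trans Ysub; rewrite (eq_row_sub (Ordinal lm)) // rowK.
have <- : poly_rV ('X^j : {poly F}) *m C = poly_rV 'X^(j.+1).
  rewrite mul_mulX_mx ?size_polyXn; last exact: ltnW.
  by rewrite -exprS modp_small // sq size_polyXn.
apply: submx_trans (submxMr C (IH (ltnW jn))) _.
by rewrite -intertwine submxMl.
Qed.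

End Realization.

(** * Subtracting a square-zero matrix *)

Section SquareZeroShift.
Set Implicit Arguments.
Unset Strict Implicit.
Variable F : fieldType.

Definition sqz_realizes n (q : {poly F}) (A : 'M[F]_n) :=
  exists K N : 'M[F]_n, [/\ K \in unitmx, square_zero N &
    (A - N) *m K = K *m mulX_mx n q].

Lemma sqz_realizes_sim n q (A B S : 'M[F]_n) :
  S \in unitmx -> S *m A = B *m S -> sqz_realizes q B -> sqz_realizes q A.
Proof.
move=> Su SA [K [N [Ku N0 BK]]].
have AE : A = invmx S *m B *m S by rewrite -mulmxA -SA mulKmx.
exists (invmx S *m K), (invmx S *m N *m S); split.
- by rewrite unitmx_mul unitmx_inv Su.
- move: N0; rewrite /square_zero !expr2 -!mulmxE => N0.
  by rewrite !mulmxA mulmxK // -(mulmxA _ N N) N0 mulmx0 mul0mx.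
- rewrite AE -mulmxBl -mulmxBr -!mulmxA mulKVmx //.
  by rewrite [in LHS](mulmxA _ _ K) -BK !mulmxA.
Qed.

Lemma sqz_realizes_power n q j l (A : 'M[F]_n) :
  mulX_mx n q ^+ j = mulX_mx n q ^+ l -> sqz_realizes q A ->
  exists P N : 'M[F]_n, [/\ P ^+ j = P ^+ l, square_zero N & A = P + N].
Proof.
move=> Cjl [K [N [Ku N0 AK]]]; exists (A - N), N; split=> //.
  have powK i : (A - N) ^+ i *m K = K *m mulX_mx n q ^+ i.
    elim: i => [|i IH]; first by rewrite !expr0 mul1mx mulmx1.
    by rewrite exprSr -mulmxE -mulmxA AK mulmxA IH exprSr -mulmxE mulmxA.
  by rewrite -[LHS](mulmxK Ku) -[RHS](mulmxK Ku) !powK Cjl.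
by rewrite subrK.
Qed.

(** The difference of the two companion matrices maps [f] to
    [f`_m.-1 *: (q - p)], and [q - p] has no coefficient of index [m.-1]. *)
Lemma sqz_realizes_companion m (p q : {poly F}) :
    (0 < m)%N -> p \is monic -> size p = m.+1 -> q \is monic -> size q = m.+1 ->
    p`_m.-1 = q`_m.-1 ->
  sqz_realizes q (mulX_mx m p).
Proof.
move=> m0 pm sp qm sq pq.
exists 1%:M, (mulX_mx m p - mulX_mx m q); split; first exact: unitmx1.
- have modX (r f : {poly F}) :
      r \is monic -> size r = m.+1 -> (size f <= m)%N ->
      ('X * f) %% r = 'X * f - f`_m.-1 *: r.
    move=> rm sr sf; apply/esym/(modpP (q := (f`_m.-1)%:P)).
      by rewrite mul_polyC addrC subrK.
    rewrite sr ltnS; apply/leq_sizeP => j; rewrite leq_eqVlt.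
    rewrite coefB coefZ coefXM => /predU1P[<- | mj].
      rewrite gtn_eqF //; move/monicP: rm; rewrite /lead_coef sr => ->.
      by rewrite mulr1 subrr.
    rewrite gtn_eqF ?(leq_ltn_trans _ mj) // [r`_j]nth_default ?sr //.
    rewrite [f`_j.-1]nth_default ?mulr0 ?subrr //.
    by apply: leq_trans sf _; lia.
  have NE (f : {poly F}) : (size f <= m)%N ->
      poly_rV f *m (mulX_mx m p - mulX_mx m q) = f`_m.-1 *: poly_rV (q - p).
    move=> sf; rewrite mulmxBr !mul_mulX_mx // -linearB /= !modX //.
    by rewrite -linearZ /= scalerBr; congr poly_rV; ring.
  rewrite /square_zero expr2 -mulmxE; apply: matrix_eq_rVpoly => f sf.
  rewrite mulmxA NE // -scalemxAl mulmx0 NE.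
    by rewrite coefB pq subrr scale0r scaler0.
  apply/leq_sizeP => j; rewrite leq_eqVlt coefB => /predU1P[<- | mj].
    move/monicP: pm; move/monicP: qm; rewrite /lead_coef sp sq /= => -> ->.
    by rewrite subrr.
  by rewrite !nth_default ?subrr ?sp ?sq.
- by rewrite subKr mulmx1 mul1mx.
Qed.

(** Replacing [B] by the companion matrix [C] of its characteristic polynomial,
    the block [G] is created by a unipotent similarity with off-diagonal block
    [G *m invmx C]; this is where [B] has to be invertible. *)
Lemma sqz_realizes_block k m (B : 'M[F]_m) (q : {poly F}) :
    (k < m)%N -> B \in unitmx -> non_derogatory B -> \tr B = 0 ->
    q \is monic -> size q = (k + m).+1 -> q`_(k + m).-1 = 0 ->
  sqz_realizes q (block_mx (0 : 'M_k) 0 0 B).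
Proof.
case: m B => // m B km Bu Bnd trB qm sq q0.
set p := char_poly B.
have pm : p \is monic by exact: char_poly_monic.
have sp : size p = m.+2 by exact: size_char_poly.
have p0 : p`_m.+1.-1 = 0 by rewrite char_poly_trace // trB oppr0.
have [v vB] := order_poly_mxminpoly B.
rewrite Bnd in vB; have Ku := krylov_unit vB.
have KB := krylov_mulX B v.
move: (krylov_mx B v m.+1) Ku KB => K Ku KB.
set C := mulX_mx m.+1 p in KB.
have Cu : C \in unitmx.
  by rewrite -[C](mulmxK Ku) -KB !unitmx_mul unitmx_inv Ku Bu.
have [k0|k0] := posnP k.
  subst k; have -> : block_mx (0 : 'M_0) 0 0 B = B.
    have shift0 (i : 'I_m.+1) : rshift 0 i = i by apply: val_inj.
    by apply/matrixP => i j; rewrite -{1}(shift0 i) -{1}(shift0 j) block_mxEdr.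
  apply: (sqz_realizes_sim Ku KB).
  by apply: sqz_realizes_companion; rewrite // p0 q0.
pose G : 'M[F]_(k, m.+1) := pid_mx k.
apply: (@sqz_realizes_sim _ _ _ (block_mx 0 G 0 C)
          (block_mx 1%:M (G *m invmx C *m K) 0 K)).
- by rewrite unitmxE det_ublock det1 mul1r -unitmxE.
- rewrite !mulmx_block !(mul0mx, mulmx0, mul1mx, add0r, addr0).
  by rewrite KB -[in LHS](mulmxA _ K) KB !mulmxA mulmxKV.
have [Phi [L [Lu LE]]] : exists (Phi : 'M[F]_(m.+1, k)) (L : 'M[F]_(k + m.+1)),
    L \in unitmx /\
    block_mx 0 (pid_mx k) Phi C *m L = L *m mulX_mx (k + m.+1) q.
  by apply: chain_realizes; rewrite ?k0 ?km // p0 q0.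
exists L, (block_mx 0 0 (- Phi) 0); split=> //.
  rewrite /square_zero expr2 -mulmxE mulmx_block.
  by rewrite !(mul0mx, mulmx0, addr0) -block_mx0.
by rewrite opp_block_mx add_block_mx !(oppr0, opprK, add0r, addr0).
Qed.

End SquareZeroShift.

Theorem corollary3p3 (F : fieldType) (n k : nat) (hk : (k < n - k)%N)
    (A22 : 'M[F]_(n - k)) (A : 'M[F]_n)
    (hA : A = zero_corner_mx hk A22)
    (A22_unit : A22 \in unitmx)
    (A22_nonderog : non_derogatory A22)
    (trA : \tr A = 0) :
  ((3 <= n)%N ->
     exists P N1 : 'M[F]_n, [/\ potent n P, square_zero N1 & A = P + N1]) /\
  ((2 <= n)%N ->
     exists T N2 : 'M[F]_n, [/\ torsion n T, square_zero N2 & A = T + N2]).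
Proof.
have realizeA (q : {poly F}) : q \is monic -> size q = n.+1 -> q`_n.-1 = 0 ->
    sqz_realizes q A.
  subst A; move: trA; rewrite /zero_corner_mx; move: (block_dim hk); move: hk.
  move: A22 A22_unit A22_nonderog; move: (n - k)%N => m B Bu Bnd km e.
  case: n / e q => q.
  rewrite castmx_id mxtrace_block mxtrace0 add0r => trB.
  exact: sqz_realizes_block.
have qcoef (r : {poly F}) : (size r < n)%N -> ('X^n + r)`_n.-1 = r`_n.-1.
  move=> rn; rewrite coefD coefXn ltn_eqF ?add0r //.
  by rewrite prednK // (leq_ltn_trans _ rn).
have qsize (r : {poly F}) : (size r < n)%N ->
    size ('X^n + r) = n.+1 /\ 'X^n + r \is monic.
  move=> rn; have lt : (size r < size ('X^n : {poly F}))%N.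
    by rewrite size_polyXn ltnS ltnW.
  split; first by rewrite size_polyDl // size_polyXn.
  by rewrite monicE lead_coefDl // lead_coefXn.
split=> hn.
  have sX : (size (- 'X : {poly F})%R < n)%N by rewrite size_polyN size_polyX.
  have [sq qm] := qsize _ sX.
  have /(sqz_realizes_power (j := n) (l := 1)) : sqz_realizes ('X^n - 'X) A.
    apply: realizeA; rewrite // qcoef // coefN coefX gtn_eqF ?oppr0 //.
    by rewrite ltn_predRL.
  by rewrite /potent expr1; apply; rewrite mulX_mx_potent // ltnW.
have s1 : (size (- 1 : {poly F})%R < n)%N by rewrite size_polyN size_poly1.
have [sq qm] := qsize _ s1.
have /(sqz_realizes_power (j := n) (l := 0)) : sqz_realizes ('X^n - 1) A.
  apply: realizeA; rewrite // qcoef // coefN coef1 gtn_eqF ?oppr0 //.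
  by rewrite ltn_predRL.
by rewrite /torsion expr0; apply; rewrite mulX_mx_torsion // ltnW.
Qed.
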